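(* Let $Z=z_1e_1+z_2e_2$ and $\mathcal V=\nu_1e_1+\nu_2e_2=\alpha_1+j\alpha_2$ be elements of $\mathbb{BC}$ with $\Re(\alpha_1)>|\Im(\alpha_2)|$. Then $$\mathcal J_{\mathcal V}(Z)=\frac{1}{\Gamma_b(\mathcal V)}\left[\sum_{s=0}^{\infty}\frac{(-1)^s}{(s!)^2}\left(\frac Z2\right)^{\mathcal V+2s}\int_D t^{s}(1-t)^{\mathcal V-1}\,dt\right],$$ where $D=(D_1(t_1),D_2(t_2))$ is the curve in $\mathbb{BC}$ with $t=t_1e_1+t_2e_2$, $0\le t_1,t_2\le 1$.
   Context: Bicomplex numbers: $\mathbb{BC}=\{\lambda_1+j\lambda_2:\lambda_1,\lambda_2\in\mathbb C(i)\}$ with commuting units $i,j$, $i^2=j^2=-1$, $k=ij$, $k^2=1$. Put $e_1=\frac{1+k}{2}$, $e_2=\frac{1-k}{2}$; then $e_1+e_2=1$, $e_l^2=e_l$, $e_1e_2=0$. Every $Z=\lambda_1+j\lambda_2$ has the unique idempotent representation $Z=z_1e_1+z_2e_2$ with $z_1=\lambda_1-i\lambda_2$, $z_2=\lambda_1+i\lambda_2\in\mathbb C(i)$. In particular $\nu_1=\alpha_1-i\alpha_2$, $\nu_2=\alpha_1+i\alpha_2$. Powers and Gamma: $Z^{\mathcal V}=z_1^{\nu_1}e_1+z_2^{\nu_2}e_2$, with complex powers $z^\nu=\exp(\nu\log z)$ for a fixed branch of $\log$ used consistently (the real branch for positive reals; at $z=0$ only when the power makes sense). $\Gamma_b(Z)=\Gamma(z_1)e_1+\Gamma(z_2)e_2$,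 with $1/\Gamma$ read as an entire function. Integration is componentwise: for $D=(D_1,D_2)$ and $g(t)=g_1(t_1)e_1+g_2(t_2)e_2$, $\int_D g(t)\,dt=\left(\int_{D_1}g_1(t_1)dt_1\right)e_1+\left(\int_{D_2}g_2(t_2)dt_2\right)e_2$; here $D_1,D_2$ are the real interval $[0,1]$. Bicomplex Bessel function: for $\mathcal V,Z\in\mathbb{BC}$, $$\mathcal J_{\mathcal V}(Z)=\sum_{s=0}^\infty\frac{(-1)^s}{\Gamma_b(\mathcal V+s+1)s!}\left(\frac Z2\right)^{\mathcal V+2s},$$ equivalently $\mathcal J_{\mathcal V}(Z)=J_{\nu_1}(z_1)e_1+J_{\nu_2}(z_2)e_2$ with $J_\nu$ the classical Bessel function of the first kind. *)

(* Defs.v *)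
From HB Require Import structures.
From mathcomp Require Import all_boot all_order all_algebra.
From mathcomp Require Import complex.
From mathcomp Require Import all_classical all_reals all_analysis.
From mathcomp Require Import ring.

Set Implicit Arguments.
Unset Strict Implicit.
Unset Printing Implicit Defensive.

Import Order.TTheory GRing.Theory Num.Theory.
Import numFieldNormedType.Exports.

Local Open Scope classical_set_scope.
Local Open Scope complex_scope.
Local Open Scope ring_scope.

Section ComplexFunctions.
Variable R : realType.

Definition cexp (z : R[i]) : R[i] :=
  (expR (complex.Re z) * cos (complex.Im z)) +i*
  (expR (complex.Re z) * sin (complex.Im z)).

(* An everywhere defined branch of log on C \ {0}, real on the positive reals;
   no continuity is required, so wherever the cut lies, any choice of values
   on it is allowed. *)
Definition log_branch (L : R[i] -> R[i]) : Prop :=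
  (forall z, z != 0 -> cexp (L z) = z) /\
  (forall x : R, 0 < x -> L x%:C = (ln x)%:C).

(* 0 ^ 0 = 1, and 0 ^ w = 0 when 0 < Re w. For the other exponents 0 ^ w makes
   no sense mathematically and the value 0 is arbitrary. *)
Definition cpow (L : R[i] -> R[i]) (z w : R[i]) : R[i] :=
  if z == 0 then (w == 0)%:R else cexp (w * L z).

Definition cintegral (D : set R) (f : R -> R[i]) : R[i] :=
  (\int[lebesgue_measure]_(t in D) complex.Re (f t)) +i*
  (\int[lebesgue_measure]_(t in D) complex.Im (f t)).

Definition cintegrable (D : set R) (f : R -> R[i]) : Prop :=
  (lebesgue_measure : set R -> \bar R).-integrable D
     (fun t => (complex.Re (f t))%:E) /\
  (lebesgue_measure : set R -> \bar R).-integrable D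
     (fun t => (complex.Im (f t))%:E).

Definition euler_gamma (z : R[i]) : R[i] :=
  cintegral `]0, +oo[ (fun t => cexp ((z - 1) * (ln t)%:C) * (expR (- t))%:C).

(* Continuation by Gamma (z + n) = z (z + 1) ... (z + n - 1) Gamma z, where n is
   the least natural number such that 0 < Re (z + n) (n = 0 if 0 < Re z).
   At the poles z = 0, -1, -2, ... the product vanishes, so that Gamma z = 0
   by the convention x / 0 = 0; hence (Gamma z)^-1 = 0 there, which is the value
   of the entire function 1 / Gamma. *)
Definition Gamma (z : R[i]) : R[i] :=
  let n := Num.truncn (1 - complex.Re z) in
  euler_gamma (z + n%:R) / \prod_(k < n) (z + k%:R).

End ComplexFunctions.

(* The pair (a, b) stands for a + j b. *)
Definition bicomplex (R : realType) : Type := (R[i] * R[i])%type.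

Section BicomplexTopology.
Variable R : realType.

(* The product topology; R[i]^o carries the topology of C. *)
HB.instance Definition _ :=
  PseudoMetricNormedZmod.copy (bicomplex R) (R[i]^o * R[i]^o)%type.

End BicomplexTopology.

Section BicomplexRing.
Variable R : realType.
Local Notation BC := (bicomplex R).

Definition bcone : BC := (1, 0).
Definition bcmul (x y : BC) : BC :=
  (x.1 * y.1 - x.2 * y.2, x.1 * y.2 + x.2 * y.1).

Fact bcmulA : associative bcmul.
Proof.
by move=> [a b] [c d] [e f]; rewrite /bcmul /=; congr pair; ring.
Qed.
Fact bcmulC : commutative bcmul.
Proof. by move=> [a b] [c d]; rewrite /bcmul /=; congr pair; ring. Qed.
Fact bcmul1 : left_id bcone bcmul.
Proof. by move=> [a b]; rewrite /bcmul /=; congr pair; ring. Qed.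
Fact bcmulDl : left_distributive bcmul +%R.
Proof.
move=> [a b] [c d] [e f]; rewrite /bcmul /=.
by apply/pair_equal_spec; split; rewrite /=; ring.
Qed.
Fact bcone_neq0 : bcone != 0 :> BC.
Proof. by apply/eqP => -[] /eqP; rewrite oner_eq0. Qed.

HB.instance Definition _ :=
  GRing.Zmodule_isComNzRing.Build BC bcmulA bcmulC bcmul1 bcmulDl bcone_neq0.

Definition bcscale (c : R[i]) (x : BC) : BC := (c * x.1, c * x.2).

Fact bcscaleA a b (x : BC) : bcscale a (bcscale b x) = bcscale (a * b) x.
Proof. by rewrite /bcscale /= !mulrA. Qed.
Fact bcscale1 : left_id 1 bcscale.
Proof. by case=> a b; rewrite /bcscale /= !mul1r. Qed.
Fact bcscaleDr : right_distributive bcscale +%R.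
Proof.
by move=> c [a b] [d e]; apply/pair_equal_spec; split; rewrite /=; ring.
Qed.
Fact bcscaleDl (x : BC) : {morph bcscale^~ x : a b / a + b}.
Proof. by move=> a b; apply/pair_equal_spec; split; rewrite /=; ring. Qed.

HB.instance Definition _ :=
  GRing.Zmodule_isLmodule.Build R[i] BC bcscaleA bcscale1 bcscaleDr bcscaleDl.

Fact bcscaleAl (a : R[i]) (x y : BC) : a *: (x * y) = (a *: x) * y.
Proof.
by case: x y => [b c] [d e]; apply/pair_equal_spec; split; rewrite /=; ring.
Qed.
Fact bcscaleAr (a : R[i]) (x y : BC) : a *: (x * y) = x * (a *: y).
Proof. by rewrite mulrC bcscaleAl mulrC. Qed.

HB.instance Definition _ := GRing.Lmodule_isLalgebra.Build R[i] BC bcscaleAl.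
HB.instance Definition _ := GRing.Lalgebra_isAlgebra.Build R[i] BC bcscaleAr.

End BicomplexRing.

Section Bicomplex.
Variable R : realType.
Local Notation BC := (bicomplex R).

Definition bcj : BC := (0, 1).
Definition bck : BC := 'i *: bcj.
Definition bce1 : BC := 2^-1 *: (1 + bck).
Definition bce2 : BC := 2^-1 *: (1 - bck).

Lemma bcE (Z : BC) : Z = Z.1%:A + bcj * Z.2%:A.
Proof.
by case: Z => a b; apply/pair_equal_spec; split; rewrite /=; ring.
Qed.

Lemma bcj2 : bcj ^+ 2 = -1.
Proof. by apply/pair_equal_spec; split; rewrite /=; ring. Qed.

Definition bcidem (z1 z2 : R[i]) : BC := z1 *: bce1 + z2 *: bce2.

Definition idem1 (Z : BC) : R[i] := Z.1 - 'i * Z.2.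
Definition idem2 (Z : BC) : R[i] := Z.1 + 'i * Z.2.

Lemma bcidemE (Z : BC) : bcidem (idem1 Z) (idem2 Z) = Z.
Proof.
have i2 : 'i * 'i = -1 :> R[i] by rewrite -expr2 sqr_i.
case: Z => a b; apply/pair_equal_spec; split; rewrite /idem1 /idem2 /=.
  by field: i2.
by field: i2.
Qed.

Lemma idem1_bcidem z1 z2 : idem1 (bcidem z1 z2) = z1.
Proof.
have i2 : 'i * 'i = -1 :> R[i] by rewrite -expr2 sqr_i.
by rewrite /idem1 /=; field: i2.
Qed.

Lemma idem2_bcidem z1 z2 : idem2 (bcidem z1 z2) = z2.
Proof.
have i2 : 'i * 'i = -1 :> R[i] by rewrite -expr2 sqr_i.
by rewrite /idem2 /=; field: i2.
Qed.

Lemma bcidemM z1 z2 w1 w2 :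
  bcidem z1 z2 * bcidem w1 w2 = bcidem (z1 * w1) (z2 * w2).
Proof.
have i2 : 'i * 'i = -1 :> R[i] by rewrite -expr2 sqr_i.
by apply/pair_equal_spec; split; rewrite /=; field: i2.
Qed.

(* D = (D1, D2) and g is of the form
   g (t1 e1 + t2 e2) = g1(t1) e1 + g2(t2) e2; the functions g1 and g2 are read
   off on the axes t = t1 e1 and t = t2 e2, see [bcintegral_idem]. *)
Definition bccoord1 (g : BC -> BC) (t1 : R) : R[i] :=
  idem1 (g (bcidem t1%:C 0)).
Definition bccoord2 (g : BC -> BC) (t2 : R) : R[i] :=
  idem2 (g (bcidem 0 t2%:C)).

Definition bcintegral (D1 D2 : set R) (g : BC -> BC) : BC :=
  bcidem (cintegral D1 (bccoord1 g)) (cintegral D2 (bccoord2 g)).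

Definition bcintegrable (D1 D2 : set R) (g : BC -> BC) : Prop :=
  cintegrable D1 (bccoord1 g) /\ cintegrable D2 (bccoord2 g).

Lemma bcintegral_idem (D1 D2 : set R) (g : BC -> BC) (g1 g2 : R -> R[i]) :
  (forall t1 t2, g (bcidem t1%:C t2%:C) = bcidem (g1 t1) (g2 t2)) ->
  bcintegral D1 D2 g = bcidem (cintegral D1 g1) (cintegral D2 g2).
Proof.
move=> gE; rewrite /bcintegral; congr (bcidem (cintegral _ _) (cintegral _ _)).
- by apply/funext => t; rewrite /bccoord1 (gE t 0) idem1_bcidem.
- by apply/funext => t; rewrite /bccoord2 (gE 0 t) idem2_bcidem.
Qed.

Definition bcpow (L : R[i] -> R[i]) (Z V : BC) : BC :=
  bcidem (cpow L (idem1 Z) (idem1 V)) (cpow L (idem2 Z) (idem2 V)).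

Definition bcGamma (Z : BC) : BC := bcidem (Gamma (idem1 Z)) (Gamma (idem2 Z)).

(* The entire function 1 / Gamma_b, which vanishes componentwise at the poles. *)
Definition bcrGamma (Z : BC) : BC :=
  bcidem (Gamma (idem1 Z))^-1 (Gamma (idem2 Z))^-1.

Lemma bcrGammaK (Z : BC) : Gamma (idem1 Z) != 0 -> Gamma (idem2 Z) != 0 ->
  bcGamma Z * bcrGamma Z = 1.
Proof.
move=> g1 g2; rewrite /bcGamma /bcrGamma bcidemM !divff//.
by apply/pair_equal_spec; split; rewrite /=; field.
Qed.

Definition bcsum (u : nat -> BC) : BC := limn (series u).

Definition bessel_term (L : R[i] -> R[i]) (V Z : BC) (s : nat) : BC :=
  ((-1) ^+ s / s`!%:R : R[i]) *:
  (bcrGamma (V + s%:R + 1) * bcpow L (2^-1 *: Z) (V + (2 * s)%:R)).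

Definition bessel (L : R[i] -> R[i]) (V Z : BC) : BC :=
  bcsum (bessel_term L V Z).

End Bicomplex.

(* Main.v *)
(* Writing everything in the idempotent basis reduces the claim to a scalar one
   for each of nu = alpha1 - i alpha2 and nu = alpha1 + i alpha2; the hypothesis
   says exactly that both have positive real part.  The scalar claim then holds
   term by term, because
     int_0^1 t^s (1 - t)^(nu - 1) dt = s! / (nu (nu + 1) ... (nu + s))
                                     = s! Gamma(nu) / Gamma(nu + s + 1).
   The first equality is an induction on s from the case s = 0 through
   t^(s+1) (1 - t)^(nu-1) = t^s (1 - t)^(nu-1) - t^s (1 - t)^nu; the second is
   the functional equation of Gamma, obtained by integrating the derivative of
   t^z e^(-t) over the positive half-line.  With the factor (z/2)^(nu+2s) the
   terms are O(|z/2|^(2s) / s!), so both series converge. *)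

Require Import Defs.
From HB Require Import structures.
From mathcomp Require Import all_boot all_order all_algebra.
From mathcomp Require Import complex.
From mathcomp Require Import all_classical all_reals all_analysis.
From mathcomp Require Import measurable_realfun ring lra.

Set Implicit Arguments.
Unset Strict Implicit.
Unset Printing Implicit Defensive.

Import Order.TTheory GRing.Theory Num.Theory.
Import numFieldNormedType.Exports.

Local Open Scope classical_set_scope.
Local Open Scope complex_scope.
Local Open Scope ring_scope.

(** * Improper integrals *)

Section ImproperIntegral.
Variable R : realType.
Implicit Types (D : set R) (f F : R -> R).
Local Notation mu := (@lebesgue_measure R).

(** An increasing sequence of compact segments filling [D]. One sequence handles both ends of an
    improper integral at once. Strictness of [a n < b n] is what the fundamental theorem of calculus
    asks of each segment. *)
Definition exhausts (a b : nat -> R) D :=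
  [/\ nonincreasing_seq a, nondecreasing_seq b, forall n, a n < b n
    & D = \bigcup_n [set` `[a n, b n]]].

Variables (a b : nat -> R) (D : set R).
Hypotheses (oD : open D) (abD : exhausts a b D).

Lemma exhausts_sub n : `[a n, b n] `<=` D.
Proof. by case: abD => _ _ _ -> x abx; exists n. Qed.

Lemma exhausts_nd : nondecreasing_seq (fun n => [set` `[a n, b n]]).
Proof.
case: abD => nia ndb _ _ m n mn; apply/subsetPset/subset_itv.
  by rewrite bnd_simp nia.
by rewrite bnd_simp ndb.
Qed.

(** Each closed segment lies inside the open set [D], so [f] and [F] are regular up to and including
    its endpoints. *)
Lemma integral_FTC_segment f F n : {in D, continuous f} ->
  (forall x, D x -> is_derive x 1 F (f x)) ->
  (\int[mu]_(x in `[a n, b n]) (f x)%:E = (F (b n) - F (a n))%:E)%E.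
Proof.
move=> cf dF; have [_ _ ab _] := abD.
have cF x : D x -> {for x, continuous F}.
  by move=> /dF dFx; apply/differentiable_continuous/derivable1_diffP.
rewrite (@continuous_FTC2 _ f F)//.
- apply: continuous_in_subspaceT => x /[1!inE] /exhausts_sub Dx.
  by apply: cf; rewrite inE.
- split.
  + move=> x xab; have /exhausts_sub/dF dFx : `[a n, b n]%classic x.
      by apply: subset_itv_oo_cc.
    exact: ex_derive.
  + apply: cvg_at_right_filter; apply: cF; apply: (@exhausts_sub n).
    by rewrite /= in_itv/= lexx ltW.
  + apply: cvg_at_left_filter; apply: cF; apply: (@exhausts_sub n).
    by rewrite /= in_itv/= lexx ltW.
- move=> x xab; have /exhausts_sub/dF dFx : `[a n, b n]%classic x.
    by apply: subset_itv_oo_cc.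
  by rewrite derive1E derive_val.
Qed.

(** By monotone convergence the integral is the limit of the segment integrals [F (b n) - F (a n)],
    each at most [M + M]. *)
Lemma integrable_bounded_primitive f F M : {in D, continuous f} ->
  (forall x, D x -> 0 <= f x) ->
  (forall x, D x -> is_derive x 1 F (f x)) ->
  (forall x, D x -> `|F x| <= M) ->
  mu.-integrable D (EFin \o f).
Proof.
move=> cf f0 dF FM; have mf :=  open_continuous_measurable_fun oD cf.
apply/integrableP; split; first exact/measurable_EFinP.
have -> : (\int[mu]_(x in D) `|(EFin \o f) x| = \int[mu]_(x in D) (f x)%:E)%E.
  by apply: eq_integral => x /[1!inE] Dx; rewrite /= ger0_norm// f0.
apply: (@le_lt_trans _ _ (M + M)%:E); last exact: ltry.
have mfab n : measurable_fun `[a n, b n] (EFin \o f).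
  apply/measurable_EFinP; apply: measurable_funS mf.
    exact: open_measurable.
  exact: exhausts_sub.
have f0ab : forall n x, `[a n, b n]%classic x -> (0 <= (EFin \o f) x)%E.
  by move=> n x abx; rewrite lee_fin f0//; exact: exhausts_sub abx.
have /cvg_lim <-// : (\int[mu]_(x in `[a n, b n]) (f x)%:E @[n --> \oo]
    --> \int[mu]_(x in D) (f x)%:E)%E.
  have [_ _ _ ->] := abD.
  by apply: ge0_nondecreasing_set_cvg_integral => //; exact: exhausts_nd.
apply: lime_le.
  apply: ereal_nondecreasing_is_cvgn.
  by apply: ge0_nondecreasing_set_nondecreasing_integral => //;
    exact: exhausts_nd.
have [_ _ ab _] := abD.
apply: nearW => n; rewrite (integral_FTC_segment n cf dF) lee_fin.
rewrite (le_trans (ler_norm _))// (le_trans (ler_normB _ _))// lerD// FM//;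
  by apply: (@exhausts_sub n); rewrite /= in_itv/= lexx ltW.
Qed.

(** Dominated convergence, with majorant the absolute value of [f], applied to the restrictions of
    [f] to the segments. *)
Lemma improper_FTC f F l : {in D, continuous f} ->
  mu.-integrable D (EFin \o f) ->
  (forall x, D x -> is_derive x 1 F (f x)) ->
  F (b n) - F (a n) @[n --> \oo] --> l ->
  \int[mu]_(x in D) f x = l.
Proof.
move=> cf fi dF Fl; have mD : measurable D by exact: open_measurable.
pose fn n := (EFin \o f) \_ `[a n, b n].
have /cvg_lim fnf : (\int[mu]_(x in D) fn n x @[n --> \oo]
    --> \int[mu]_(x in D) (f x)%:E)%E.
  have [] // := @dominated_convergence _ _ R mu D mD fn (EFin \o f)
     (fun x => `|f x|%:E).
  - move=> n; apply: measurable_funTS.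
    apply/(measurable_restrictT (EFin \o f)) => //.
    apply: (measurable_funS mD); first exact: exhausts_sub.
    exact: (measurable_int mu fi).
  - exact: (measurable_int mu fi).
  (* A point of [D] lies in some segment, hence in all later ones, so the restrictions are
     eventually constant there. *)
  - apply: aeW => x Dx; apply: cvg_near_cst.
    case: (abD) => _ _ _ DE; move: (Dx); rewrite DE => -[N _ abx].
    exists N => // n /= Nn; rewrite /fn patchE mem_set//.
    by have /subsetPset := exhausts_nd Nn; apply.
  - exact: integrable_norm.
  - apply: aeW => x n Dx; rewrite /fn patchE; case: ifPn => _.
      by rewrite lee_fin.
    by rewrite abse0 lee_fin.
rewrite /Rintegral -fnf//.
apply/EFin_inj; rewrite fineK; last first.
  by rewrite fnf// integrable_fin_num.
apply/cvg_lim => //.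
have -> : (fun n => (\int[mu]_(x in D) fn n x)%E) =
    (fun n => (F (b n) - F (a n))%:E).
  apply/funext => n; rewrite -(integral_FTC_segment n cf dF).
  rewrite [RHS]integral_mkcond [LHS]integral_mkcond; apply: eq_integral => x _.
  rewrite /fn !patchE; have [xab|//] := boolP (x \in `[a n, b n]%classic).
    by rewrite mem_set//; apply: (@exhausts_sub n); rewrite inE in xab.
  by rewrite if_same.
by apply/cvg_EFin => //; exact: nearW.
Qed.

End ImproperIntegral.

(* [R] carries two syntactically different Borel structures: the one of
   [lebesgue_measure], generated by the half-open intervals, and a copy of it
   declared on [R] itself, which is the one elaborated in [cintegrable].  They
   are exchanged by pushing forward along the identity. *)
Lemma borel_integrableE (R : realType) (D : set R) (f : R -> R) :
  measurable D ->
  (lebesgue_measure : set R -> \bar R).-integrable D (EFin \o f) =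
  (@lebesgue_measure R).-integrable D (EFin \o f).
Proof.
move=> mD; rewrite !unlock; apply/asbool_equiv_eq.
have intE : measurable_fun D f ->
    (\int[(lebesgue_measure : set R -> \bar R)]_(x in D) `|(EFin \o f) x| =
     \int[lebesgue_measure]_(x in D) `|(EFin \o f) x|)%E.
  move=> mf.
  rewrite -[X in integral X _ _]/(pushforward (@lebesgue_measure R)
    (idfun : measurableTypeR R -> R)) ge0_integral_pushforward//.
    by move=> _ Y mY; rewrite setTI.
  by apply: measurableT_comp => //; exact/measurable_EFinP.
split=> -[mf foo]; split; first exact: mf.
- by rewrite -intE//; exact/measurable_EFinP.
- exact: mf.
- by rewrite intE//; exact/measurable_EFinP.
Qed.

(** * Integrals of complex functions *)

Section ComplexIntegral.
Variable R : realType.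
Implicit Types (D : set R) (f g F : R -> R[i]) (c w z : R[i]).
Local Notation mu := (@lebesgue_measure R).
Local Notation borel := (@measurable _ (measurableTypeR R)).
Local Notation Re := (@complex.Re R).
Local Notation Im := (@complex.Im R).

(** Passes to the Borel structure of [mu], in which all later integrability arguments are carried
    out. *)
Lemma cintegrableE D f : borel D -> cintegrable D f <->
  mu.-integrable D (EFin \o (Re \o f)) /\
  mu.-integrable D (EFin \o (Im \o f)).
Proof. by move=> mD; rewrite -!borel_integrableE. Qed.

Lemma cintegrableB D f g : borel D -> cintegrable D f ->
  cintegrable D g -> cintegrable D (fun t => f t - g t).
Proof.
move=> mD /(cintegrableE _ mD)[f1 f2] /(cintegrableE _ mD)[g1 g2].
apply/(cintegrableE _ mD); split.
- apply: (eq_integrable mD _ _ _ (integrableB mD f1 g1)) => // t _ /=.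
  by rewrite raddfB.
- apply: (eq_integrable mD _ _ _ (integrableB mD f2 g2)) => // t _ /=.
  by rewrite raddfB.
Qed.

Lemma cintegralB D f g : borel D -> cintegrable D f ->
  cintegrable D g ->
  cintegral D (fun t => f t - g t) = cintegral D f - cintegral D g.
Proof.
move=> mD /(cintegrableE _ mD)[f1 f2] /(cintegrableE _ mD)[g1 g2].
rewrite /cintegral.
under [X in X +i* _]eq_Rintegral do rewrite raddfB/=.
under [X in _ +i* X]eq_Rintegral do rewrite raddfB/=.
by rewrite !RintegralB.
Qed.

Lemma ReM z w : Re (z * w) =
  Re z * Re w - Im z * Im w.
Proof. by case: z w => [? ?] [? ?]. Qed.

Lemma ImM z w : Im (z * w) =
  Re z * Im w + Im z * Re w.
Proof. by case: z w => [? ?] [? ?]. Qed.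

Lemma integrableZl_EFin D (r : R) (h : R -> R) :
  borel D ->
  mu.-integrable D (EFin \o h) -> mu.-integrable D (EFin \o (fun t => r * h t)).
Proof.
by move=> mD hi; apply: (eq_integrable mD _ _ _ (integrableZl mD r hi)).
Qed.

Lemma cintegrableZ D c f : borel D -> cintegrable D f ->
  cintegrable D (fun t => c * f t).
Proof.
move=> mD /(cintegrableE _ mD)[f1 f2]; apply/(cintegrableE _ mD); split.
- apply: (eq_integrable mD _ _ _ (integrableB mD (integrableZl mD (Re c) f1)
    (integrableZl mD (Im c) f2))) => // t _ /=.
  by rewrite ReM.
- apply: (eq_integrable mD _ _ _ (integrableD mD (integrableZl mD (Re c) f2)
    (integrableZl mD (Im c) f1))) => // t _ /=.
  by rewrite ImM.
Qed.

Lemma cintegralZ D c f : borel D -> cintegrable D f ->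
  cintegral D (fun t => c * f t) = c * cintegral D f.
Proof.
move=> mD /(cintegrableE _ mD)[f1 f2]; rewrite /cintegral.
under [X in X +i* _]eq_Rintegral do rewrite ReM.
under [X in _ +i* X]eq_Rintegral do rewrite ImM.
rewrite RintegralB//; [|exact: integrableZl_EFin..].
rewrite RintegralD//; [|exact: integrableZl_EFin..].
by rewrite !RintegralZl//; case: c.
Qed.

Lemma eq_cintegral D f g : {in D, f =1 g} -> cintegral D f = cintegral D g.
Proof.
by move=> fg; rewrite /cintegral; congr (_ +i* _);
  apply: eq_Rintegral => t tD; rewrite /= fg.
Qed.

Lemma eq_cintegrable D f g : borel D -> {in D, f =1 g} ->
  cintegrable D f -> cintegrable D g.
Proof.
by move=> mD fg /(cintegrableE _ mD)[f1 f2]; apply/(cintegrableE _ mD); split;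
  [apply: (eq_integrable mD _ _ _ f1)|apply: (eq_integrable mD _ _ _ f2)];
  move=> // t tD; rewrite /= fg.
Qed.

(** * Passing from open to closed intervals *)

Lemma itvoo_itvcc (a b : R) : a < b ->
  [set` `[a, b]] `\` [set a; b] = [set` `]a, b[].
Proof.
move=> ab; apply/seteqP; split => t /=; rewrite !in_itv/=.
  move=> [/andP[at_ tb]] /not_orP[/eqP ta /eqP tb'].
  by rewrite !lt_neqAle at_ tb tb' eq_sym ta.
move=> /andP[at_ tb]; split; first by rewrite !ltW.
by case=> tE; move: at_ tb; rewrite tE ltxx.
Qed.

Lemma measurable_set2 (a b : R) : borel [set a; b].
Proof. exact: measurableU. Qed.

Lemma lebesgue_measure_set2 (a b : R) : mu [set a; b] = 0%E.
Proof.
by apply: null_set_setU => //; exact: lebesgue_measure_set1.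
Qed.

(** The endpoints form a null set. This links the closed interval of the theorem with the open one,
    on which the primitives are differentiable. *)
Lemma integrable_itvoo_itvcc (a b : R) (f : R -> \bar R) : a < b ->
  mu.-integrable `]a, b[ f -> mu.-integrable `[a, b] f.
Proof.
move=> ab fi.
apply/(negligible_integrable (measurable_set2 a b) _ _
  (lebesgue_measure_set2 a b)).
- exact: measurable_itv.
- apply/emeasurable_fun_itv_obnd_cbndP/emeasurable_fun_itv_bndo_bndcP.
  exact: (measurable_int mu fi).
- by rewrite itvoo_itvcc.
Qed.

Lemma Rintegral_itvoo_itvcc (a b : R) (f : R -> R) : a < b ->
  mu.-integrable `]a, b[ (EFin \o f) ->
  \int[mu]_(x in `]a, b[) f x = \int[mu]_(x in `[a, b]) f x.
Proof.
move=> ab fi.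
rewrite /Rintegral [in RHS](negligible_integral (measurable_set2 a b))//.
- by rewrite itvoo_itvcc.
- exact: integrable_itvoo_itvcc.
- exact: lebesgue_measure_set2.
Qed.

Lemma cintegrable_itvoo_itvcc (a b : R) f : a < b ->
  cintegrable `]a, b[ f -> cintegrable `[a, b] f.
Proof.
move=> ab /cintegrableE[]// f1 f2; apply/cintegrableE => //.
by split; exact: integrable_itvoo_itvcc.
Qed.

Lemma cintegral_itvoo_itvcc (a b : R) f : a < b ->
  cintegrable `]a, b[ f -> cintegral `]a, b[ f = cintegral `[a, b] f.
Proof.
by move=> ab /cintegrableE[]// f1 f2; rewrite /cintegral !Rintegral_itvoo_itvcc.
Qed.

(** Differentiability and continuity are split into real and imaginary parts to match [cintegral],
    so the real theorems apply to each part. *)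
Definition is_cderive (t : R) F c :=
  is_derive t 1 (Re \o F) (Re c) /\
  is_derive t 1 (Im \o F) (Im c).

Definition ccontinuous_at (t : R) f :=
  {for t, continuous (Re \o f)} /\
  {for t, continuous (Im \o f)}.

Lemma is_cderive_continuous t F c : is_cderive t F c -> ccontinuous_at t F.
Proof.
by case=> F1 F2; split; apply/differentiable_continuous/derivable1_diffP.
Qed.

Lemma ccontinuousB t f g : ccontinuous_at t f -> ccontinuous_at t g ->
  ccontinuous_at t (fun x => f x - g x).
Proof.
move=> [f1 f2] [g1 g2]; split.
- have -> : Re \o (fun x => f x - g x) =
    (Re \o f) \- (Re \o g).
    by apply/funext => x /=; rewrite raddfB.
  exact: continuousB.
- have -> : Im \o (fun x => f x - g x) =
    (Im \o f) \- (Im \o g).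
    by apply/funext => x /=; rewrite raddfB.
  exact: continuousB.
Qed.

Lemma ccontinuousZ t c f : ccontinuous_at t f ->
  ccontinuous_at t (fun x => c * f x).
Proof.
move=> [f1 f2]; split.
- have -> : Re \o (fun x => c * f x) =
    (Re c \*o (Re \o f)) \- (Im c \*o (Im \o f)).
    by apply/funext => x /=; rewrite ReM.
  by apply: continuousB; apply: continuousM => //; exact: cst_continuous.
- have -> : Im \o (fun x => c * f x) =
    (Re c \*o (Im \o f)) \+ (Im c \*o (Re \o f)).
    by apply/funext => x /=; rewrite ImM.
  by apply: continuousD; apply: continuousM => //; exact: cst_continuous.
Qed.

Lemma is_cderiveZ t c F d : is_cderive t F d ->
  is_cderive t (fun x => c * F x) (c * d).
Proof.
move=> [F1 F2]; split.
- have -> : Re \o (fun x => c * F x) =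
    (Re c \*o (Re \o F)) \- (Im c \*o (Im \o F)).
    by apply/funext => x /=; rewrite ReM.
  rewrite ReM; apply: is_deriveB; exact: is_deriveZ.
- have -> : Im \o (fun x => c * F x) =
    (Re c \*o (Im \o F)) \+ (Im c \*o (Re \o F)).
    by apply/funext => x /=; rewrite ImM.
  rewrite ImM; apply: is_deriveD; exact: is_deriveZ.
Qed.

(** Continuity on an open set supplies measurability; the common real majorant [h] of both parts
    supplies finiteness. *)
Lemma cintegrable_dominated D f (h : R -> R) : open D ->
  (forall t, D t -> ccontinuous_at t f) ->
  (forall t, D t -> `|Re (f t)| <= h t /\ `|Im (f t)| <= h t) ->
  mu.-integrable D (EFin \o h) -> cintegrable D f.
Proof.
move=> oD cf fh hi; have mD : borel D by exact: open_measurable.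
apply/(cintegrableE _ mD); split; apply: (le_integrable mD _ _ hi).
- apply/measurable_EFinP; apply: open_continuous_measurable_fun => // t.
  rewrite inE => Dt.
  exact: (cf t Dt).1.
- move=> t Dt; rewrite /= lee_fin; apply: le_trans (ler_norm _).
  exact: (fh t Dt).1.
- apply/measurable_EFinP; apply: open_continuous_measurable_fun => // t.
  rewrite inE => Dt.
  exact: (cf t Dt).2.
- move=> t Dt; rewrite /= lee_fin; apply: le_trans (ler_norm _).
  exact: (fh t Dt).2.
Qed.

Lemma improper_cFTC a b D f F l : open D -> exhausts a b D ->
  (forall t, D t -> ccontinuous_at t f) ->
  cintegrable D f ->
  (forall t, D t -> is_cderive t F (f t)) ->
  Re (F (b n)) - Re (F (a n)) @[n --> \oo] --> Re l ->
  Im (F (b n)) - Im (F (a n)) @[n --> \oo] --> Im l ->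
  cintegral D f = l.
Proof.
move=> oD abD cf /cintegrableE[]; first exact: open_measurable.
move=> f1 f2 dF l1 l2; rewrite /cintegral.
have -> : \int[mu]_(t in D) Re (f t) = Re l.
  apply: (@improper_FTC _ _ _ _ oD abD _ (Re \o F) _ _ f1 _ l1) => t.
    by rewrite inE => /cf[].
  by move=> /dF[].
have -> : \int[mu]_(t in D) Im (f t) = Im l.
  apply: (@improper_FTC _ _ _ _ oD abD _ (Im \o F) _ _ f2 _ l2) => t.
    by rewrite inE => /cf[].
  by move=> /dF[].
by case: l {l1 l2}.
Qed.

(** One formula for both primitives used below: [phi = ln] with [psi t = expR (- t)] for Gamma, and
    [phi t = ln (1 - t)] with [psi = 1] for Beta. *)
Lemma is_cderive_cexp w (phi psi : R -> R) (t dphi dpsi : R) :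
  is_derive t 1 phi dphi -> is_derive t 1 psi dpsi ->
  is_cderive t (fun x => cexp (w * (phi x)%:C) * (psi x)%:C)
    (cexp (w * (phi t)%:C) * (w * (psi t * dphi)%:C + dpsi%:C)).
Proof.
move=> dph dps; case: w => u v.
have E x : cexp ((u +i* v) * (phi x)%:C) =
    (expR (u * phi x) * cos (v * phi x)) +i*
    (expR (u * phi x) * sin (v * phi x)).
  by rewrite /cexp /= !mulr0 subr0 add0r.
have dexp : is_derive t 1 (fun x => expR (u * phi x))
    (expR (u * phi t) * (u * dphi)).
  by apply: (@is_derive1_comp _ expR (fun x => u * phi x)); exact: is_deriveZ.
have dcos : is_derive t 1 (fun x => cos (v * phi x))
    (- sin (v * phi t) * (v * dphi)).
  by apply: (@is_derive1_comp _ cos (fun x => v * phi x)); exact: is_deriveZ.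
have dsin : is_derive t 1 (fun x => sin (v * phi x))
    (cos (v * phi t) * (v * dphi)).
  by apply: (@is_derive1_comp _ sin (fun x => v * phi x)); exact: is_deriveZ.
split.
- rewrite (_ : _ \o _ =
      (fun x => expR (u * phi x)) * (fun x => cos (v * phi x)) * psi).
    apply: is_derive_eq; rewrite E /GRing.scale !mulrfctE /=; ring.
  by apply/funext => x; rewrite compE E !mulrfctE /=; ring.
- rewrite (_ : _ \o _ =
      (fun x => expR (u * phi x)) * (fun x => sin (v * phi x)) * psi).
    apply: is_derive_eq; rewrite E /GRing.scale !mulrfctE /=; ring.
  by apply/funext => x; rewrite compE E !mulrfctE /=; ring.
Qed.

Lemma normr_Re_cexp z : `|Re (cexp z)| <= expR (Re z).
Proof.
rewrite /cexp /= normrM ger0_norm ?expR_ge0//.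
by rewrite ler_piMr ?expR_ge0// ler_norml cos_geN1 cos_le1.
Qed.

Lemma normr_Im_cexp z : `|Im (cexp z)| <= expR (Re z).
Proof.
rewrite /cexp /= normrM ger0_norm ?expR_ge0//.
by rewrite ler_piMr ?expR_ge0// ler_norml sin_geN1 sin_le1.
Qed.

Lemma cexpD z w : cexp (z + w) = cexp z * cexp w.
Proof.
case: z w => [a b] [c d]; rewrite /cexp /= expRD cosD sinD.
by apply/eqP; rewrite eq_complex /=; apply/andP; split; apply/eqP; ring.
Qed.

Lemma cexp_real (x : R) : cexp x%:C = (expR x)%:C.
Proof. by rewrite /cexp /= cos0 sin0 mulr1 mulr0. Qed.

End ComplexIntegral.

(** * The functional equation of Gamma *)

Section GammaFunction.
Variable R : realType.
Implicit Types (t x : R) (w z : R[i]).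
Local Notation mu := (@lebesgue_measure R).
Local Notation borel := (@measurable _ (measurableTypeR R)).
Local Notation Re := (@complex.Re R).
Local Notation Im := (@complex.Im R).

(** The right end is [n.+2] rather than [n.+1] so that the segment for [n = 0] is not reduced to the
    point 1. *)
Lemma exhausts_pos :
  exhausts (fun n => n.+1%:R^-1) (fun n => n.+2%:R) [set` `]0%R : R, +oo[].
Proof.
split.
- by move=> m n mn; rewrite lef_pV2 ?posrE// ler_nat ltnS.
- by move=> m n mn; rewrite ler_nat !ltnS.
- by move=> n; rewrite (@le_lt_trans _ _ 1)// ?invf_le1 ?ler1n ?ltr1n.
apply/seteqP; split => x /=; rewrite in_itv/= andbT.
  (* The sum of the two integer parts serves both ends: [x] must stay below [n.+2] and its inverse
     below [n.+1]. *)
  move=> x0; exists (Num.truncn x + Num.truncn x^-1)%N => //=.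
  rewrite in_itv/=; apply/andP; split.
    rewrite invf_ple ?posrE// (le_trans (ltW (truncnS_gt _)))// ler_nat.
    by rewrite ltnS leq_addl.
  rewrite (le_trans (ltW (truncnS_gt _)))// ler_nat.
  by rewrite !ltnS (leq_trans (leq_addr _ _) (leqnSn _)).
by move=> [n _] /=; rewrite in_itv/= => /andP[+ _]; apply: lt_le_trans.
Qed.

(** The function t^x e^(-t) is largest at t = x, with value x^x e^(-x). This comes from ln y <= y -
    1 taken at y = t / x. *)
Lemma expR_ln_le x t : 0 < x -> 0 < t ->
  expR (x * ln t) <= expR (x * ln x - x) * expR t.
Proof.
move=> x0 t0; rewrite -expRD ler_expR.
have : ln (t / x) <= t / x - 1.
  rewrite -[X in ln X](addrNK 1) addrC le_ln1Dx//.
  by rewrite ltrBrDr addNr divr_gt0.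
rewrite ln_div ?posrE// lerBlDr -(ler_pM2l x0).
rewrite mulrDr mulrBr mulrCA divff ?gt_eqF// !mulr1; lra.
Qed.

Lemma is_derive_expR_ln x (phi : R -> R) t dphi : 0 < phi t ->
  is_derive t 1 phi dphi ->
  is_derive t 1 (fun y => expR (x * ln (phi y)))
    (expR (x * ln (phi t)) * (x * ((phi t)^-1 * dphi))).
Proof.
move=> t0 dp; apply: (@is_derive1_comp _ expR (fun y => x * ln (phi y))).
apply: is_deriveZ; apply: (@is_derive1_comp _ (@ln R) phi).
exact: is_derive1_ln.
Qed.

Lemma is_derive_continuous (f : R -> R) t d :
  is_derive t 1 f d -> {for t, continuous f}.
Proof. by move=> df; apply/differentiable_continuous/derivable1_diffP. Qed.

Lemma cvgr0_le (g u : nat -> R) : (forall n, `|g n| <= u n) ->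
  u n @[n --> \oo] --> (0 : R) -> g n @[n --> \oo] --> (0 : R).
Proof.
move=> gu u0; apply/norm_cvg0P.
apply: (@squeeze_cvgr _ _ _ _ (cst 0) u) => //; last exact: cvg_cst.
by apply: nearW => n; rewrite normr_ge0 gu.
Qed.

Lemma cvg_expR_ln0 x (u : nat -> R) : 0 < x -> (forall n, 0 < u n) ->
  u n @[n --> \oo] --> (0 : R) -> expR (x * ln (u n)) @[n --> \oo] --> (0 : R).
Proof.
move=> x0 u0 ucvg.
have -> : (fun n => expR (x * ln (u n))) = (fun n => u n `^ x).
  by apply/funext => n; rewrite /powR gt_eqF.
by have /cvg_at_rightP := powR_cvg0 x0; apply.
Qed.

Lemma is_derive_expRN t : is_derive t 1 (fun y => expR (- y)) (- expR (- t)).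
Proof.
have := @is_derive1_comp _ expR -%R t (expR (- t)) (- 1) _ _.
by rewrite mulrN1; apply.
Qed.

(* The function [x p' / (1 + p)^2] with [p t = t ^ x], whose primitive
   [- 1 / (1 + p)] is bounded, dominates [t ^ (x - 1) e ^ (- t)] near 0 and
   near infinity at the same time. *)
Lemma integrable_gamma_bound x : 0 < x ->
  mu.-integrable `]0, +oo[
    (EFin \o (fun t => expR ((x - 1) * ln t) * expR (- t))).
Proof.
move=> x0; pose p t := expR (x * ln t).
have p0 t : 0 < p t by exact: expR_gt0.
have p1 t : 1 + p t != 0 by rewrite gt_eqF// addr_gt0.
have dp t : 0 < t -> is_derive t 1 p (p t * (x / t)).
  move=> t0; apply: is_derive_eq (@is_derive_expR_ln x id t 1 t0 _) _.
  by rewrite /p mulr1.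
pose h t := (1 + p t) ^- 2 * (p t * (x / t)).
have ch : {in `]0, +oo[%classic, continuous h}.
  move=> t /[1!inE]/=; rewrite in_itv/= andbT => t0.
  have /is_derive_continuous cp := dp t t0.
  rewrite /h; apply: cvgM.
    apply: cvgV; first by rewrite expf_neq0.
    have c1 : 1 + p y @[y --> t] --> 1 + p t.
      by apply: cvgD => //; exact: cvg_cst.
    by rewrite expr2; under eq_fun do rewrite expr2; exact: cvgM.
  apply: cvgM => //; apply: cvgM; first exact: cvg_cst.
  by apply: cvgV; [rewrite gt_eqF|exact: cvg_id].
have h0 t : 0 < t -> 0 <= h t.
  move=> t0; rewrite ltW// mulr_gt0 ?invr_gt0 ?exprn_gt0 ?addr_gt0//.
  by rewrite mulr_gt0// divr_gt0.
have hi : mu.-integrable `]0, +oo[ (EFin \o h).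
  apply: (@integrable_bounded_primitive _ _ _ _ _ exhausts_pos _
    (fun t => - (1 + p t)^-1) 1).
  - exact: interval_open.
  - exact: ch.
  - by move=> t /=; rewrite in_itv/= andbT; exact: h0.
  - move=> t /=; rewrite in_itv/= andbT => t0.
    have dp1 : is_derive t 1 (fun t => 1 + p t) (0 + p t * (x / t)).
      by apply: is_deriveD; exact: dp.
    have dV := is_deriveV (f := fun t => 1 + p t) (p1 t) dp1.
    have dNV := is_deriveN dV; apply: (is_derive_eq dNV).
    by rewrite add0r scaleNr opprK.
  - move=> t _; rewrite normrN ger0_norm ?invr_ge0 ?addr_ge0// ?(ltW (p0 t))//.
    by rewrite invf_le1 ?addr_gt0// lerDl ltW.
(* After cancelling [p t / t], the bound needed is (1 + p)^2 <= C x e^t. It follows from (1 + p)^2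
   <= 2 (1 + p^2), from 1 <= e^t, and from [expR_ln_le] at exponent 2x for p^2 = t^(2x). *)
pose C := 2 * (1 + expR ((x + x) * ln (x + x) - (x + x))) / x.
have Chi : mu.-integrable `]0, +oo[ (EFin \o (fun t => C * h t)).
  by apply: integrableZl_EFin => //; exact: measurable_itv.
have C0 : 0 <= C by rewrite divr_ge0 ?(ltW x0)// mulr_ge0// addr_ge0// expR_ge0.
apply: (le_integrable _ _ _ Chi).
- exact: measurable_itv.
- apply/measurable_EFinP; apply: open_continuous_measurable_fun.
    exact: interval_open.
  move=> t /[1!inE]/=; rewrite in_itv/= andbT => t0.
  apply: cvgM.
    exact: is_derive_continuous (@is_derive_expR_ln (x - 1) id t 1 t0 _).
  exact: is_derive_continuous (is_derive_expRN t).
move=> t /=; rewrite in_itv/= andbT => t0; rewrite lee_fin.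
rewrite (ger0_norm (mulr_ge0 (expR_ge0 _) (expR_ge0 _))).
rewrite (ger0_norm (mulr_ge0 C0 (h0 t t0))).
have -> : expR ((x - 1) * ln t) = p t / t.
  by rewrite mulrBl mul1r expRB lnK ?posrE.
rewrite expRN.
have -> : C * h t = (p t / t) * ((C * x) / (1 + p t) ^+ 2).
  by rewrite /h; field; rewrite p1 gt_eqF.
rewrite ler_pM2l ?divr_gt0//.
rewrite -[leLHS]mul1r ler_pdivrMr ?expR_gt0//.
rewrite mulrAC ler_pdivlMr ?exprn_gt0 ?addr_gt0// mul1r.
rewrite /C divfK ?gt_eqF//.
have e1 : 1 <= expR t by rewrite (le_trans _ (expR_ge1Dx t))// lerDl ltW.
have p2 : p t ^+ 2 <= expR ((x + x) * ln (x + x) - (x + x)) * expR t.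
  by rewrite expr2 /p -expRD -mulrDl expR_ln_le// addr_gt0.
by have := sqr_ge0 (1 - p t); nra.
Qed.

Definition gamma_kernel z t : R[i] :=
  cexp ((z - 1) * (ln t)%:C) * (expR (- t))%:C.

Lemma ReM_real z x : Re (z * x%:C) = Re z * x.
Proof. by rewrite ReM /= mulr0 subr0. Qed.

Lemma ImM_real z x : Im (z * x%:C) = Im z * x.
Proof. by rewrite ImM /= mulr0 add0r. Qed.

Lemma normr_ReIm_cexpM w (x : R) : 0 < x ->
  `|Re (cexp w * x%:C)| <= expR (Re w) * x /\
  `|Im (cexp w * x%:C)| <= expR (Re w) * x.
Proof.
move=> x0; rewrite ReM_real ImM_real.
by split; rewrite normrM (gtr0_norm x0) ler_pM2r//;
  [exact: normr_Re_cexp|exact: normr_Im_cexp].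
Qed.

Lemma gamma_kernel_continuous z t : 0 < t -> ccontinuous_at t (gamma_kernel z).
Proof.
move=> t0; apply: is_cderive_continuous.
exact: (is_cderive_cexp _ (is_derive1_ln t0) (is_derive_expRN t)).
Qed.

(** Both parts of the kernel are bounded by the real kernel with exponent [Re z - 1], because |e^w|
    = e^(Re w). *)
Lemma gamma_kernel_integrable z : 0 < Re z ->
  cintegrable `]0, +oo[ (gamma_kernel z).
Proof.
move=> z0; apply: (cintegrable_dominated _ _ _ (integrable_gamma_bound z0)).
- exact: interval_open.
- by move=> t /=; rewrite in_itv/= andbT; exact: gamma_kernel_continuous.
move=> t _; have -> : (Re z - 1) * ln t = Re ((z - 1) * (ln t)%:C).
  by rewrite ReM_real raddfB.
exact/normr_ReIm_cexpM/expR_gt0.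
Qed.

(** The function F(t) = t^z e^(-t) has derivative z t^(z-1) e^(-t) - t^z e^(-t) and tends to 0 at
    both ends of the half-line, so this derivative has integral 0. *)
Lemma euler_gammaS z : 0 < Re z -> euler_gamma (z + 1) = z * euler_gamma z.
Proof.
move=> z0; have z10 : 0 < Re (z + 1) by rewrite raddfD /= addr_gt0.
have mD : borel `]0, +oo[.
  exact: measurable_itv.
have kz := gamma_kernel_integrable z0.
have kz1 := gamma_kernel_integrable z10.
pose F t := cexp (z * (ln t)%:C) * (expR (- t))%:C.
pose f t := z * gamma_kernel z t - gamma_kernel (z + 1) t.
have FE t : `|Re (F t)| <= expR (Re z * ln t) * expR (- t) /\
    `|Im (F t)| <= expR (Re z * ln t) * expR (- t).
  by rewrite -ReM_real; exact/normr_ReIm_cexpM/expR_gt0.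
have Fb : expR (Re z * ln n.+2%:R) * expR (- n.+2%:R) @[n --> \oo] --> (0 : R).
  (* One power more than needed: t^(x+1) <= K e^t with x = Re z gives t^x e^(-t) <= K / t, which
     tends to 0. *)
  pose K := expR ((Re z + 1) * ln (Re z + 1) - (Re z + 1)).
  apply: (@squeeze_cvgr _ _ _ _ (cst 0) (fun n => K * harmonic n)).
  - apply: nearW => n; rewrite mulr_ge0 ?expR_ge0//=.
    have x10 : 0 < Re z + 1 by rewrite addr_gt0.
    have N0 : 0 < n.+2%:R :> R by [].
    rewrite expRN ler_pdivrMr ?expR_gt0//.
    apply: (le_trans _ (_ : K * n.+2%:R^-1 * expR n.+2%:R <= _)).
      have := expR_ln_le x10 N0; rewrite -/K mulrDl mul1r expRD lnK ?posrE//.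
      by rewrite -ler_pdivlMr// mulrAC.
    rewrite ler_pM2r ?expR_gt0// ler_pM2l ?expR_gt0//.
    by rewrite lef_pV2 ?posrE// ler_nat.
  - exact: cvg_cst.
  - by rewrite -(mulr0 K); apply: cvgM; [exact: cvg_cst|exact: cvg_harmonic].
have Fa : expR (Re z * ln n.+1%:R^-1) * expR (- n.+1%:R^-1)
    @[n --> \oo] --> (0 : R).
  (* Near 0 the exponential factor is at most 1, and t^(Re z) alone tends to 0. *)
  apply: (@squeeze_cvgr _ _ _ _ (cst 0) (fun n => expR (Re z * ln n.+1%:R^-1))).
  - apply: nearW => n; rewrite mulr_ge0 ?expR_ge0//=.
    by rewrite ler_piMr ?expR_ge0// expR_le1 oppr_le0 invr_ge0.
  - exact: cvg_cst.
  - apply: (@cvg_expR_ln0 _ (fun n => n.+1%:R^-1)) => //.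
    exact: cvg_harmonic.
have : cintegral `]0, +oo[ f = 0.
  apply: (@improper_cFTC _ _ _ _ f F 0 _ exhausts_pos).
  - exact: interval_open.
  - move=> t /=; rewrite in_itv/= andbT => t0; apply: ccontinuousB.
      by apply: ccontinuousZ; exact: gamma_kernel_continuous.
    exact: gamma_kernel_continuous.
  - by apply: cintegrableB => //; exact: cintegrableZ.
  - move=> t /=; rewrite in_itv/= andbT => t0.
    suff -> : f t = cexp (z * (ln t)%:C) *
        (z * (expR (- t) * t^-1)%:C + (- expR (- t))%:C).
      exact: (is_cderive_cexp _ (is_derive1_ln t0) (is_derive_expRN t)).
    have cE : cexp ((z - 1) * (ln t)%:C) = cexp (z * (ln t)%:C) * (t^-1)%:C.
      by rewrite mulrBl mul1r cexpD -rmorphN cexp_real expRN lnK ?posrE.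
    by rewrite /f /gamma_kernel addrK cE rmorphM rmorphN /=; ring.
  - rewrite -(subrr 0); apply: cvgB.
      exact: cvgr0_le (fun n => (FE _).1) Fb.
    exact: cvgr0_le (fun n => (FE _).1) Fa.
  - rewrite -(subrr 0); apply: cvgB.
      exact: cvgr0_le (fun n => (FE _).2) Fb.
    exact: cvgr0_le (fun n => (FE _).2) Fa.
rewrite /f cintegralB//; last exact: cintegrableZ.
by rewrite cintegralZ// => /eqP; rewrite subr_eq0 => /eqP/esym.
Qed.

End GammaFunction.

(** * The Beta integral *)

Section GammaBeta.
Variable R : realType.
Implicit Types (t x : R) (w z nu : R[i]).
Local Notation mu := (@lebesgue_measure R).
Local Notation Re := (@complex.Re R).
Local Notation Im := (@complex.Im R).

(** Here [1 - Re z < 1], so the truncation is 0 and the product in the continuation formula is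
    empty. *)
Lemma Gamma_euler z : 0 < Re z -> Gamma z = euler_gamma z.
Proof.
move=> z0; rewrite /Gamma (_ : Num.truncn (1 - Re z) = 0%N).
  by rewrite big_ord0 invr1 mulr1 addr0.
by apply/truncn0Pn; rewrite -ltNge ltrBlDr ltrDl.
Qed.

Lemma Re_addn z n : Re (z + n%:R) = Re z + n%:R.
Proof. by rewrite raddfD /= raddfMn. Qed.

Lemma Gamma_addn z n : 0 < Re z ->
  Gamma (z + n%:R) = Gamma z * \prod_(k < n) (z + k%:R).
Proof.
move=> z0; elim: n => [|n IHn]; first by rewrite big_ord0 addr0 mulr1.
have zn0 : 0 < Re (z + n%:R) by rewrite Re_addn ltr_wpDr.
rewrite -natr1 addrA Gamma_euler; last by rewrite raddfD /= addr_gt0.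
rewrite euler_gammaS// -Gamma_euler// IHn big_ord_recr/=.
by rewrite mulrC -mulrA.
Qed.

Lemma neq0_Re z : 0 < Re z -> z != 0.
Proof. by apply: contraTneq => ->; rewrite ltxx. Qed.

(** The shift by 3 keeps the margin at most 1/3; with 2 the segment for [n = 0] would be the single
    point 1/2. *)
Lemma exhausts_oo01 : exhausts (fun n => n.+3%:R^-1)
  (fun n => 1 - n.+3%:R^-1) [set` `]0%R : R, 1[].
Proof.
split.
- by move=> m n mn; rewrite lef_pV2 ?posrE// ler_nat ltnS.
- by move=> m n mn; rewrite lerD2l lerN2 lef_pV2 ?posrE// ler_nat !ltnS.
- move=> n; have : n.+3%:R^-1 <= 3^-1 :> R.
    by rewrite lef_pV2 ?posrE// ler_nat.
  by move: (n.+3%:R^-1 : R) => e e3; lra.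
apply/seteqP; split => x /=; rewrite in_itv/=.
  move=> /andP[x0 x1]; have x10 : 0 < 1 - x by rewrite subr_gt0.
  exists (Num.truncn (1 - x)^-1 + Num.truncn x^-1)%N => //=.
  rewrite in_itv/=; apply/andP; split.
    rewrite invf_ple ?posrE// (le_trans (ltW (truncnS_gt _)))// ler_nat.
    by rewrite ltnS leqW// leqW// leq_addl.
  rewrite lerBrDl -lerBrDr invf_ple ?posrE//.
  rewrite (le_trans (ltW (truncnS_gt _)))// ler_nat.
  by rewrite ltnS leqW// leqW// leq_addr.
move=> [n _] /=; rewrite in_itv/= => /andP[nx xn].
have n0 : 0 < n.+3%:R^-1 :> R by [].
by move: (n.+3%:R^-1 : R) nx xn n0 => e ? ? ?; apply/andP; split; lra.
Qed.

(** The power (1 - t)^(nu - 1) for t < 1, written with the real logarithm and so independent of the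
    branch. *)
Definition beta_kernel nu t : R[i] := cexp ((nu - 1) * (ln (1 - t))%:C).

Lemma is_derive_ln1B t : t < 1 ->
  is_derive t 1 (fun y => ln (1 - y)) (- (1 - t)^-1).
Proof.
move=> t1; have d1 : is_derive t 1 (fun y : R => 1 - y) (0 - 1).
  exact: is_deriveB.
have dln := @is_derive1_ln R (1 - t); rewrite subr_gt0 in dln.
have := @is_derive1_comp _ (@ln R) (fun y => 1 - y) t _ _ (dln t1) d1.
by rewrite sub0r mulrN1.
Qed.

Lemma is_cderive_cexp_ln1B w t : t < 1 ->
  is_cderive t (fun y => cexp (w * (ln (1 - y))%:C))
    (- w * (cexp ((w - 1) * (ln (1 - t))%:C))).
Proof.
move=> t1.
have := is_cderive_cexp w (is_derive_ln1B t1) (is_derive_cst (1 : R) t 1).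
have -> : (fun x => cexp (w * (ln (1 - x))%:C) * (cst 1 x)%:C) =
    (fun x => cexp (w * (ln (1 - x))%:C)).
  by apply/funext => x; rewrite mulr1.
have -> // : cexp (w * (ln (1 - t))%:C) *
    (w * (cst 1 t * - (1 - t)^-1)%:C + 0%:C) =
   - w * cexp ((w - 1) * (ln (1 - t))%:C).
rewrite mulrBl mul1r cexpD -rmorphN cexp_real expRN lnK ?posrE ?subr_gt0//.
by rewrite mul1r rmorphN /=; ring.
Qed.

Lemma beta_kernel_continuous nu t : t < 1 -> ccontinuous_at t (beta_kernel nu).
Proof.
by move=> t1; exact: is_cderive_continuous (is_cderive_cexp_ln1B _ t1).
Qed.

(** With x = Re nu, the majorant (1 - t)^(x - 1) has the primitive -(1 - t)^x / x, bounded by 1 / x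
    on the interval. *)
Lemma beta_kernel_integrable nu : 0 < Re nu ->
  cintegrable `]0, 1[ (beta_kernel nu).
Proof.
move=> n0; set x := Re nu in n0 *.
have dE t : t < 1 -> is_derive t 1
    (fun y => - x^-1 * expR (x * ln (1 - y))) (expR ((x - 1) * ln (1 - t))).
  (* The real derivative is read off as the real part of the complex one at the real exponent
     [x]. *)
  move=> t1; have := (is_cderive_cexp_ln1B x%:C t1).1.
  set d := Re _ => dR.
  have -> : (fun y => - x^-1 * expR (x * ln (1 - y))) =
     (- x^-1 \*o (Re \o (fun y => cexp (x%:C * (ln (1 - y))%:C)))).
    apply/funext => y.
    rewrite -[RHS]/(- x^-1 * Re (cexp (x%:C * (ln (1 - y))%:C))).
    by rewrite -rmorphM cexp_real.
  apply: (is_derive_eq (is_deriveZ (- x^-1) dR)).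
  have -> : d = - x * expR ((x - 1) * ln (1 - t)).
    rewrite /d (_ : (x%:C - 1) * (ln (1 - t))%:C = ((x - 1) * ln (1 - t))%:C).
      by rewrite cexp_real ReM_real raddfN.
    by rewrite rmorphM rmorphB rmorph1.
  rewrite /GRing.scale/=.
  by field; rewrite gt_eqF.
have hi : mu.-integrable `]0, 1[
    (EFin \o (fun t => expR ((x - 1) * ln (1 - t)))).
  apply: (@integrable_bounded_primitive _ _ _ _ _ exhausts_oo01 _
    (fun y => - x^-1 * expR (x * ln (1 - y))) x^-1).
  - exact: interval_open.
  - move=> t /[1!inE]/=; rewrite in_itv/= => /andP[_ t1].
    have /is_cderive_continuous[] := is_cderive_cexp_ln1B (x - 1)%:C t1.
    rewrite (_ : Re \o _ = (fun t => expR ((x - 1) * ln (1 - t))))//.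
    by apply/funext => y; rewrite compE -rmorphM cexp_real.
  - by move=> t _; exact: expR_ge0.
  - by move=> t /=; rewrite in_itv/= => /andP[_]; exact: dE.
  - move=> t /=; rewrite in_itv/= => /andP[t0 t1].
    rewrite normrM normrN (ger0_norm (expR_ge0 _)).
    rewrite ger0_norm ?invr_ge0 ?(ltW n0)//.
    rewrite ler_piMr ?invr_ge0 ?(ltW n0)// expR_le1.
    by rewrite mulr_ge0_le0 ?(ltW n0)// ln_le0// gerBl ltW.
apply: (cintegrable_dominated _ _ _ hi).
- exact: interval_open.
- by move=> t /=; rewrite in_itv/= => /andP[_]; exact: beta_kernel_continuous.
move=> t _; have -> : (x - 1) * ln (1 - t) = Re ((nu - 1) * (ln (1 - t))%:C).
  by rewrite ReM_real raddfB.
by split; [exact: normr_Re_cexp|exact: normr_Im_cexp].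
Qed.

(** The primitive -(1 - t)^nu / nu is continuous at 0 with value -1 / nu, and it tends to 0 at 1
    since Re nu > 0. *)
Lemma cintegral_beta_kernel nu : 0 < Re nu ->
  cintegral `]0, 1[ (beta_kernel nu) = nu^-1.
Proof.
move=> n0; have nu0 := neq0_Re n0.
pose F t := - nu^-1 * cexp (nu * (ln (1 - t))%:C).
have dF t : t < 1 -> is_cderive t F (beta_kernel nu t).
  move=> t1; have := is_cderiveZ (- nu^-1) (is_cderive_cexp_ln1B nu t1).
  by rewrite mulrA mulrNN mulVf// mul1r.
have F0 : F 0 = - nu^-1.
  by rewrite /F subr0 ln1 mulr0 cexp_real expR0 mulr1.
have [cR cI] : ccontinuous_at 0 F by apply: is_cderive_continuous (dF _ ltr01).
have cvg_inv : n.+3%:R^-1 @[n --> \oo] --> (0 : R).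
  apply: (@squeeze_cvgr _ _ _ _ (cst 0) harmonic).
  - apply: nearW => n; rewrite invr_ge0 ler0n/=.
    by rewrite lef_pV2 ?posrE// ler_nat !ltnS leqW.
  - exact: cvg_cst.
  - exact: cvg_harmonic.
(* This is (1 - t)^nu at the right end t = 1 - 1/(n+3) of the n-th segment. *)
pose c n := cexp (nu * (ln (n.+3%:R^-1))%:C).
have cE n : F (1 - n.+3%:R^-1) = - nu^-1 * c n by rewrite /F subKr.
have cle n : `|Re (c n)| <= expR (Re nu * ln n.+3%:R^-1) /\
             `|Im (c n)| <= expR (Re nu * ln n.+3%:R^-1).
  by rewrite -ReM_real; split; [exact: normr_Re_cexp|exact: normr_Im_cexp].
have cb : expR (Re nu * ln n.+3%:R^-1) @[n --> \oo] --> (0 : R).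
  exact: (@cvg_expR_ln0 _ _ (fun n => n.+3%:R^-1)).
have cR0 : Re (c n) @[n --> \oo] --> (0 : R).
  exact: cvgr0_le (fun n => (cle n).1) cb.
have cI0 : Im (c n) @[n --> \oo] --> (0 : R).
  exact: cvgr0_le (fun n => (cle n).2) cb.
apply: (@improper_cFTC _ _ _ _ (beta_kernel nu) F (nu^-1) _ exhausts_oo01).
- exact: interval_open.
- by move=> t /=; rewrite in_itv/= => /andP[_]; exact: beta_kernel_continuous.
- exact: beta_kernel_integrable.
- by move=> t /=; rewrite in_itv/= => /andP[_]; exact: dF.
- under eq_fun do rewrite cE ReM.
  rewrite (_ : Re nu^-1 = Re (- nu^-1) * 0 - Im (- nu^-1) * 0 - Re (F 0)).
    apply: cvgB; last exact: (cvg_comp _ _ cvg_inv cR).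
    by apply: cvgB; apply: cvgM => //; exact: cvg_cst.
  by rewrite F0 !mulr0 raddfN opprK subr0 add0r.
- under eq_fun do rewrite cE ImM.
  rewrite (_ : Im nu^-1 = Re (- nu^-1) * 0 + Im (- nu^-1) * 0 - Im (F 0)).
    apply: cvgB; last exact: (cvg_comp _ _ cvg_inv cI).
    by apply: cvgD; apply: cvgM => //; exact: cvg_cst.
  by rewrite F0 !mulr0 raddfN opprK addr0 add0r.
Qed.

End GammaBeta.

(** * The Beta integral with integer first exponent, and powers along a branch *)

Section BetaIntegral.
Variable R : realType.
Implicit Types (t x : R) (w z nu : R[i]).
Local Notation borel := (@measurable _ (measurableTypeR R)).
Local Notation Re := (@complex.Re R).
Local Notation Im := (@complex.Im R).

Definition pochhammer nu n := \prod_(k < n) (nu + k%:R).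

Lemma pochhammer_neq0 nu n : 0 < Re nu -> pochhammer nu n != 0.
Proof.
move=> n0; rewrite /pochhammer; apply/prodf_neq0 => k _; apply: neq0_Re.
by rewrite Re_addn ltr_wpDr.
Qed.

Lemma pochhammerSr nu n :
  pochhammer nu n.+1 = pochhammer nu n * (nu + n%:R).
Proof. by rewrite /pochhammer big_ord_recr. Qed.

Lemma pochhammerSl nu n :
  pochhammer nu n.+1 = nu * pochhammer (nu + 1) n.
Proof.
rewrite /pochhammer big_ord_recl addr0; congr (_ * _).
by apply: eq_bigr => k _; rewrite lift0 -addrA nat1r.
Qed.

(** The induction on [s] is uniform in [nu], since its step uses the hypothesis at both [nu] and
    [nu + 1]. Integrability is carried along because the integral of the difference is split. *)
Lemma beta_integral_oo nu s : 0 < Re nu ->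
  let f t := t%:C ^+ s * cexp ((nu - 1) * (ln (1 - t))%:C) in
  cintegrable `]0, 1[ f /\
  cintegral `]0, 1[ f = s`!%:R / pochhammer nu s.+1.
Proof.
have mD : borel `]0, 1[.
  exact: measurable_itv.
elim: s nu => [|s IHs] nu n0 /=.
  have fE : {in `]0, 1[%classic, (fun t => cexp ((nu - 1) * (ln (1 - t))%:C)) =1
     (fun t => t%:C ^+ 0 * cexp ((nu - 1) * (ln (1 - t))%:C))}.
    by move=> t _; rewrite expr0 mul1r.
  split; first exact: eq_cintegrable mD fE (beta_kernel_integrable n0).
  rewrite -(eq_cintegral fE) cintegral_beta_kernel//.
  by rewrite pochhammerSr /pochhammer big_ord0 mul1r addr0 fact0 mul1r.
have n10 : 0 < Re (nu + 1) by rewrite raddfD /= addr_gt0.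
have [i1 e1] := IHs _ n0; have [i2 e2] := IHs _ n10.
have fE : {in `]0, 1[%classic,
    (fun t => t%:C ^+ s * cexp ((nu - 1) * (ln (1 - t))%:C) -
              t%:C ^+ s * cexp ((nu + 1 - 1) * (ln (1 - t))%:C)) =1
    (fun t => t%:C ^+ s.+1 * cexp ((nu - 1) * (ln (1 - t))%:C))}.
  move=> t; rewrite inE/= in_itv/= => /andP[_ t1].
  have -> : (nu + 1 - 1) * (ln (1 - t))%:C =
      (nu - 1) * (ln (1 - t))%:C + (ln (1 - t))%:C.
    by rewrite addrAC [LHS]mulrDl mul1r.
  rewrite cexpD cexp_real lnK ?posrE ?subr_gt0//.
  by rewrite rmorphB rmorph1 exprS; ring.
split; first exact: eq_cintegrable mD fE (cintegrableB mD i1 i2).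
rewrite -(eq_cintegral fE) (cintegralB mD i1 i2) e1 e2.
have P0 := pochhammer_neq0 s.+1 n0.
have Q0 := pochhammer_neq0 s.+1 n10.
have s0 : nu + s.+1%:R != 0 by apply: neq0_Re; rewrite Re_addn ltr_wpDr.
have nu0 := neq0_Re n0.
(* Splitting off the first or the last factor of the same product expresses the symbol at [nu + 1]
   through the one at [nu]. *)
have PQ := pochhammerSl nu s.+1; rewrite pochhammerSr in PQ.
rewrite [pochhammer nu s.+2]pochhammerSr.
have -> : pochhammer (nu + 1) s.+1 = pochhammer nu s.+1 * (nu + s.+1%:R) / nu.
  by rewrite PQ mulrAC divff// mul1r.
rewrite factS natrM; move: (s.+1%:R : R[i]) s0 => a s0.
by field; rewrite P0 nu0 s0.
Qed.

Variable L : R[i] -> R[i].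
Hypothesis hL : log_branch L.

(** For 0 < t < 1 the base 1 - t is a positive real, where every admissible branch is the real
    logarithm. The endpoints, including t = 1 with base 0, form a null set. *)
Lemma beta_integral nu s : 0 < Re nu ->
  let f t := t%:C ^+ s * cpow L (1 - t%:C) (nu - 1) in
  cintegrable `[0, 1] f /\
  cintegral `[0, 1] f = s`!%:R / pochhammer nu s.+1.
Proof.
move=> n0 f; have mD : borel `]0, 1[.
  exact: measurable_itv.
have [fi <-] := beta_integral_oo s n0.
have fE : {in `]0, 1[%classic,
  (fun t => t%:C ^+ s * cexp ((nu - 1) * (ln (1 - t))%:C)) =1 f}.
  move=> t; rewrite inE/= in_itv/= => /andP[_ t1].
  have t10 : 0 < 1 - t by rewrite subr_gt0.
  rewrite /f /cpow -(rmorph1 (real_complex R)) -rmorphB hL.2//.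
  have /negPf -> : (1 - t)%:C != 0 :> R[i] by exact: neq0_Re.
  by rewrite rmorph1.
rewrite (eq_cintegral fE).
have fi' := eq_cintegrable mD fE fi.
split; first exact: cintegrable_itvoo_itvcc.
by rewrite cintegral_itvoo_itvcc.
Qed.

(** For nonzero [w], exp(n L(w)) = w^n whatever the branch. For [w = 0] both exponents have positive
    real part, hence are nonzero, and both sides vanish. *)
Lemma cpow_addn nu w n : 0 < Re nu ->
  cpow L w (nu + n%:R) = cpow L w nu * w ^+ n.
Proof.
move=> n0; rewrite /cpow; have [->|w0] := eqVneq w 0.
  have /negPf -> := neq0_Re n0; rewrite mul0r.
  have /negPf -> // : nu + n%:R != 0.
  by apply: neq0_Re; rewrite Re_addn ltr_wpDr.
rewrite mulrDl cexpD; congr (_ * _); elim: n => [|n IHn].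
  by rewrite mul0r expr0 -[0]/(0%:C) cexp_real expR0.
by rewrite -natr1 mulrDl cexpD IHn mul1r hL.1// exprSr.
Qed.

End BetaIntegral.

(** * Idempotent components and convergence *)

Section Idempotents.
Variable R : realType.
Local Notation BC := (bicomplex R).
Implicit Types (X Y : BC) (c z : R[i]).

Lemma mulii : 'i * 'i = -1 :> R[i].
Proof. by rewrite -expr2 sqr_i. Qed.

(** Registering the two projections as ring morphisms lets bicomplex sums and powers be computed
    componentwise. *)
Lemma idem1_is_zmod_morphism : zmod_morphism (@idem1 R).
Proof. by move=> X Y; rewrite /idem1 /=; ring. Qed.
Lemma idem1_is_monoid_morphism : monoid_morphism (@idem1 R).
Proof.
split; first by rewrite /idem1 /= mulr0 subr0.
by move=> X Y; rewrite /idem1 /=; ring: mulii.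
Qed.
HB.instance Definition _ :=
  GRing.isZmodMorphism.Build BC R[i] (@idem1 R) idem1_is_zmod_morphism.
HB.instance Definition _ :=
  GRing.isMonoidMorphism.Build BC R[i] (@idem1 R) idem1_is_monoid_morphism.

Lemma idem2_is_zmod_morphism : zmod_morphism (@idem2 R).
Proof. by move=> X Y; rewrite /idem2 /=; ring. Qed.
Lemma idem2_is_monoid_morphism : monoid_morphism (@idem2 R).
Proof.
split; first by rewrite /idem2 /= mulr0 addr0.
by move=> X Y; rewrite /idem2 /=; ring: mulii.
Qed.
HB.instance Definition _ :=
  GRing.isZmodMorphism.Build BC R[i] (@idem2 R) idem2_is_zmod_morphism.
HB.instance Definition _ :=
  GRing.isMonoidMorphism.Build BC R[i] (@idem2 R) idem2_is_monoid_morphism.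

Lemma idem1Z c X : idem1 (c *: X) = c * idem1 X.
Proof. by rewrite /idem1 /=; ring. Qed.

Lemma idem2Z c X : idem2 (c *: X) = c * idem2 X.
Proof. by rewrite /idem2 /=; ring. Qed.

Lemma idem1_addn X n : idem1 (X + n%:R) = idem1 X + n%:R.
Proof. by rewrite [LHS]raddfD /= rmorph_nat. Qed.

Lemma idem2_addn X n : idem2 (X + n%:R) = idem2 X + n%:R.
Proof. by rewrite [LHS]raddfD /= rmorph_nat. Qed.

Lemma bcidemD (z1 z2 w1 w2 : R[i]) :
  bcidem z1 z2 + bcidem w1 w2 = bcidem (z1 + w1) (z2 + w2).
Proof. by rewrite /bcidem !scalerDl addrACA. Qed.

Lemma bcidemZ c (z1 z2 : R[i]) :
  c *: bcidem z1 z2 = bcidem (c * z1) (c * z2).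
Proof. by rewrite /bcidem scalerDr !scalerA. Qed.

Lemma series_bcidem (u1 u2 : nat -> R[i]) n :
  series (fun k => bcidem (u1 k) (u2 k)) n = bcidem (series u1 n) (series u2 n).
Proof.
elim: n => [|n IHn]; last by rewrite !seriesSr IHn bcidemD.
by rewrite /series /= !big_nil /bcidem !scale0r addr0.
Qed.

Lemma bcintegrable_idem (D1 D2 : set R) (g : BC -> BC) (g1 g2 : R -> R[i]) :
  (forall t1 t2, g (bcidem t1%:C t2%:C) = bcidem (g1 t1) (g2 t2)) ->
  cintegrable D1 g1 -> cintegrable D2 g2 -> bcintegrable D1 D2 g.
Proof.
move=> gE i1 i2; split.
- by rewrite (_ : bccoord1 g = g1)//; apply/funext => t;
    rewrite /bccoord1 (gE t 0) idem1_bcidem.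
- by rewrite (_ : bccoord2 g = g2)//; apply/funext => t;
    rewrite /bccoord2 (gE 0 t) idem2_bcidem.
Qed.

(** The topology is the product one in the coordinates of a + j b, and these are linear combinations
    of the idempotent components. *)
Lemma cvg_bcidem (u1 u2 : nat -> R[i]) (l1 l2 : R[i]) :
  (u1 n : R[i]^o) @[n --> \oo] --> (l1 : R[i]^o) ->
  (u2 n : R[i]^o) @[n --> \oo] --> (l2 : R[i]^o) ->
  bcidem (u1 n) (u2 n) @[n --> \oo] --> bcidem l1 l2.
Proof.
move=> cu1 cu2.
have cZ (a b : R[i]) : (u1 n * a + u2 n * b : R[i]^o) @[n --> \oo]
    --> (l1 * a + l2 * b : R[i]^o).
  by apply: cvgD; apply: cvgM; [exact: cu1|exact: (@cvg_cst R[i]^o)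
                               |exact: cu2|exact: (@cvg_cst R[i]^o)].
have E (z1 z2 : R[i]) : bcidem z1 z2 = (z1 * (bce1 R).1 + z2 * (bce2 R).1,
   z1 * (bce1 R).2 + z2 * (bce2 R).2) by [].
under eq_fun do rewrite E.
rewrite E.
have H := cvg_pair (cZ (bce1 R).1 (bce2 R).1) (cZ (bce1 R).2 (bce2 R).2).
exact: H.
Qed.

End Idempotents.

(** * Convergence of the scalar series and comparison of its terms *)

Section ComplexSeries.
Variable R : realType.
Local Notation Re := (@complex.Re R).
Local Notation Im := (@complex.Im R).
Implicit Types (z w nu : R[i]).

Lemma normc_ge_Im z : `|Im z|%:C <= `|z|.
Proof.
have i1 : `|'i%C : R[i]| = 1 by rewrite normc_def /= expr0n expr1n add0r sqrtr1.
have -> : `|z| = `|z * 'i%C| by rewrite normrM i1 mulr1.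
by rewrite (le_trans _ (normc_ge_Re _))// ReiNIm normrN.
Qed.

Lemma cvg_real_complex (u : nat -> R) (l : R) : u n @[n --> \oo] --> l ->
  ((u n)%:C : R[i]^o) @[n --> \oo] --> (l%:C : R[i]^o).
Proof.
move=> ul; apply/cvgrPdist_lt => e e0.
have eE : e = (Re e)%:C by rewrite RRe_real// gtr0_real.
have Re0 : 0 < Re e by move: e0; rewrite eE ltcR.
have /cvgrPdist_lt/(_ _ Re0) := ul; apply: filterS => n.
by rewrite -rmorphB normc_def /= expr0n addr0 sqrtr_sqr eE ltcR.
Qed.

(** Comparison with [v] makes the real and imaginary series absolutely convergent, and their limits
    recombine. *)
Lemma is_cvg_series_complex (u : nat -> R[i]) (v : nat -> R) :
  (forall n, `|u n| <= (v n)%:C) -> cvgn (series v) ->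
  cvgn (series (u : nat -> R[i]^o)).
Proof.
move=> uv cv.
have v0 n : 0 <= v n by have := le_trans (normr_ge0 _) (uv n); rewrite ler0c.
have cvg_part (f : nat -> R) : (forall n, `|f n| <= v n) -> cvgn (series f).
  move=> fv; apply: normed_cvg; apply: (series_le_cvg _ v0 fv cv) => n.
  exact: normr_ge0.
have cR : cvgn (series (Re \o u)).
  by apply: cvg_part => n; rewrite -lecR (le_trans (normc_ge_Re _)).
have cI : cvgn (series (Im \o u)).
  by apply: cvg_part => n; rewrite -lecR (le_trans (normc_ge_Im _)).
have sE : series (u : nat -> R[i]^o) =
    (fun n => (series (Re \o u) n)%:C + 'i * (series (Im \o u) n)%:C).
  apply/funext => n; rewrite [LHS]complexE.
  by rewrite /series /= !raddf_sum.
apply/cvg_ex; eexists; rewrite sE.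
apply: cvgD; first exact: cvg_real_complex cR.
by apply: cvgM; [exact: (@cvg_cst R[i]^o)|exact: cvg_real_complex cI].
Qed.

(** The first factor has modulus at least [Re nu]; every later one, nu + k with k >= 1, has modulus
    at least 1. *)
Lemma normr_pochhammer_ge nu n : 0 < Re nu ->
  (Re nu)%:C <= `|pochhammer nu n.+1|.
Proof.
move=> n0; have geRe z : 0 < Re z -> (Re z)%:C <= `|z|.
  by move=> z0; rewrite -[X in X%:C]gtr0_norm// normc_ge_Re.
elim: n => [|n IHn].
  by rewrite /pochhammer big_ord1 addr0 geRe.
rewrite pochhammerSr normrM -[leLHS]mulr1 ler_pM//.
  by rewrite ler0c ltW.
have Ren : Re (nu + n.+1%:R) = Re nu + n.+1%:R by rewrite Re_addn.
rewrite (le_trans _ (geRe _ _)) ?Ren ?ltr_wpDr//.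
by rewrite -(rmorph1 (real_complex R)) lecR ler_wpDl ?ler1n// ltW.
Qed.

Variable L : R[i] -> R[i].
Hypothesis hL : log_branch L.

(** One idempotent component of a term of the right-hand series, with the Beta integral evaluated;
    [w] stands for z/2. *)
Definition bessel_beta_term nu w s : R[i] :=
  (-1) ^+ s / (s`!%:R ^+ 2) *
  (cpow L w (nu + (2 * s)%:R) * (s`!%:R / pochhammer nu s.+1)).

Lemma bessel_beta_termE nu w s : 0 < Re nu ->
  (-1) ^+ s / s`!%:R *
    ((Gamma (nu + s.+1%:R))^-1 * cpow L w (nu + (2 * s)%:R)) =
  (Gamma nu)^-1 * bessel_beta_term nu w s.
Proof.
move=> n0; rewrite /bessel_beta_term Gamma_addn// -/(pochhammer _ _).
(* The inverse of [Gamma nu] becomes an opaque factor common to both sides; only the Pochhammer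
   symbol and the factorial are cancelled. *)
move: (Gamma nu) => G; rewrite invfM; move: G^-1 (cpow _ _ _) => g c.
have P0 := pochhammer_neq0 s.+1 n0.
have f0 : s`!%:R != 0 :> R[i] by rewrite pnatr_eq0 -lt0n fact_gt0.
move: ((-1) ^+ s) (s`!%:R : R[i]) f0 => a b b0.
by field; rewrite P0.
Qed.

Lemma is_cvg_series_bessel_beta nu w : 0 < Re nu ->
  cvgn (series (bessel_beta_term nu w : nat -> R[i]^o)).
Proof.
move=> n0.
have real_norm z : `|z| = (Re `|z|)%:C by rewrite RRe_real// normr_real.
(* The majorant is C times the exponential series at r^2, the Pochhammer denominator being at least
   [Re nu] in modulus. [Re] turns moduli, which are elements of [R[i]], into reals. *)
pose r := Re `|w|; pose C := Re `|cpow L w nu| / Re nu.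
apply: (@is_cvg_series_complex _ (C *: exp_coeff (r ^+ 2))); last first.
  exact/is_cvg_seriesZ/is_cvg_series_exp_coeff.
move=> n; have f0 : n`!%:R != 0 :> R[i] by rewrite pnatr_eq0 -lt0n fact_gt0.
have P0 := pochhammer_neq0 n.+1 n0.
have -> : bessel_beta_term nu w n =
    cpow L w nu * ((-1) ^+ n * w ^+ (2 * n) / n`!%:R) / pochhammer nu n.+1.
  rewrite /bessel_beta_term cpow_addn//.
  move: ((-1) ^+ n) (w ^+ (2 * n)) (n`!%:R : R[i]) f0 => a b c c0.
  by field; rewrite P0.
rewrite !normrM !normfV normrX normrN1 expr1n mul1r normrX normr_nat.
have -> : ((C *: exp_coeff (r ^+ 2)) n)%:C =
    `|cpow L w nu| * (`|w| ^+ (2 * n) / n`!%:R) / (Re nu)%:C.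
  rewrite -[LHS]/((C * ((r ^+ 2) ^+ n / n`!%:R))%:C) /C -exprM mulrAC.
  rewrite 2!rmorphM fmorphV rmorphM fmorphV rmorphXn rmorph_nat.
  by rewrite [in RHS](real_norm (cpow L w nu)) [in RHS](real_norm w).
rewrite ler_wpM2l//.
rewrite lef_pV2 ?posrE ?normr_gt0// ?ltcR//; exact: normr_pochhammer_ge.
Qed.

End ComplexSeries.

(** * The bicomplex identity, assembled from its idempotent components *)

Theorem theorem3p1 (R : realType) (L : R[i] -> R[i]) (Z V : bicomplex R)
    (alpha1 alpha2 : R[i]) :
  log_branch L ->
  V = alpha1%:A + bcj R * alpha2%:A ->
  `|complex.Im alpha2| < complex.Re alpha1 ->
  let g (s : nat) (t : bicomplex R) : bicomplex R :=
    t ^+ s * bcpow L (1 - t) (V - 1) in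
  let u (s : nat) : bicomplex R :=
    ((-1) ^+ s / (s`!%:R ^+ 2) : R[i]) *:
    (bcpow L (2^-1 *: Z) (V + (2 * s)%:R) *
     bcintegral `[0, 1] `[0, 1] (g s)) in
  [/\ cvgn (series (bessel_term L V Z)),
      forall s, bcintegrable `[0, 1] `[0, 1] (g s),
      cvgn (series u) &
      bessel L V Z = bcrGamma V * bcsum u].
Proof.
move=> hL VE; rewrite ltr_norml => /andP[ha1 ha2] g u.
have V_pair : V = (alpha1, alpha2) by rewrite [RHS]bcE.
(* The two real parts are Re alpha1 + Im alpha2 and Re alpha1 - Im alpha2. *)
have n1 : 0 < complex.Re (idem1 V).
  rewrite V_pair /idem1/=; case: (alpha1) (alpha2) ha1 ha2 => [a b] [c d] /=.
  by rewrite mul0r mul1r sub0r opprK => *; lra.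
have n2 : 0 < complex.Re (idem2 V).
  rewrite V_pair /idem2/=; case: (alpha1) (alpha2) ha1 ha2 => [a b] [c d] /=.
  by rewrite mul0r mul1r sub0r => *; lra.
set nu1 := idem1 V in n1 *; set nu2 := idem2 V in n2 *.
pose w1 := 2^-1 * idem1 Z; pose w2 := 2^-1 * idem2 Z.
pose f nu s t := (t%:C : R[i]) ^+ s * cpow L (1 - t%:C) (nu - 1).
have gE s (t1 t2 : R) : g s (bcidem t1%:C t2%:C) =
    bcidem (f nu1 s t1) (f nu2 s t2).
  rewrite /g -[_ ^+ s]bcidemE bcidemM !rmorphXn !rmorphB !rmorph1.
  by rewrite /= !idem1_bcidem !idem2_bcidem.
have [i1 i2] : (forall s, cintegrable `[0, 1] (f nu1 s)) /\
    (forall s, cintegrable `[0, 1] (f nu2 s)).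
  by split=> s;
    [exact: (beta_integral hL s n1).1|exact: (beta_integral hL s n2).1].
have uE s : u s =
    bcidem (bessel_beta_term L nu1 w1 s) (bessel_beta_term L nu2 w2 s).
  rewrite /u (bcintegral_idem _ _ (gE s)).
  rewrite (beta_integral hL s n1).2 (beta_integral hL s n2).2.
  by rewrite /bcpow bcidemM bcidemZ !idem1Z !idem2Z idem1_addn idem2_addn.
have tE s : bessel_term L V Z s = bcrGamma V * u s.
  rewrite uE /bessel_term /bcrGamma /bcpow bcidemM bcidemM bcidemZ
    !idem1Z !idem2Z.
  rewrite -[V + s%:R + 1]addrA natr1 !idem1_addn !idem2_addn.
  by rewrite !bessel_beta_termE.
have c1 := is_cvg_series_bessel_beta hL (w := w1) n1.
have c2 := is_cvg_series_bessel_beta hL (w := w2) n2.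
set l1 := limn _ in c1; set l2 := limn _ in c2.
have sE : series u = (fun n => bcidem (series (bessel_beta_term L nu1 w1) n)
    (series (bessel_beta_term L nu2 w2) n)).
  apply/funext => n; rewrite -series_bcidem.
  by congr (series _ n); exact/funext.
have cu : series u @ \oo --> bcidem l1 l2.
  by rewrite sE; have cb := cvg_bcidem c1 c2; exact: cb.
have ct : series (bessel_term L V Z) @ \oo --> bcrGamma V * bcidem l1 l2.
  (* The factor 1 / Gamma_b is distributed over the components, so that continuity of scalar
     multiplication suffices. *)
  have tsE : series (bessel_term L V Z) = (fun n => bcidem
      ((Gamma nu1)^-1 * series (bessel_beta_term L nu1 w1) n)
      ((Gamma nu2)^-1 * series (bessel_beta_term L nu2 w2) n)).
    apply/funext => n; rewrite -bcidemM -series_bcidem /series/= mulr_sumr.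
    by apply: eq_bigr => k _; rewrite tE uE.
  have cM (c l : R[i]) (b : nat -> R[i]) : (b n : R[i]^o) @[n --> \oo]
      --> (l : R[i]^o) -> (c * b n : R[i]^o) @[n --> \oo] --> (c * l : R[i]^o).
    by move=> bl; apply: cvgM; [exact: (@cvg_cst R[i]^o)|exact: bl].
  rewrite bcidemM tsE.
  by have cb := cvg_bcidem (cM _ _ _ c1) (cM _ _ _ c2); exact: cb.
(* Uniqueness of limits lets both sums, defined by [limn], be read off from the two convergences. *)
have hd : hausdorff_space (bicomplex R) by exact: norm_hausdorff.
split.
- by apply/cvg_ex; eexists; exact: ct.
- by move=> s; exact: bcintegrable_idem (gE s) (i1 s) (i2 s).
- by apply/cvg_ex; eexists; exact: cu.
- by rewrite /bessel /bcsum (cvg_lim hd cu) (cvg_lim hd ct).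
Qed.
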